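(* Let $X$ be a Tychonoff space with at least two points, and let $\overline{0}\in C_p(X)$ denote the constant function with value $0$. The following statements are equivalent. (1) $\mathscr{F}[C_p(X)]$ is SHD. (2) $\mathscr{F}[C_p(X)]$ is WSHD. (3) $\mathscr{F}[C_p(X)]$ is OHD. (4) $\mathscr{F}[C_p(X)]$ is UC. (5) $\mathscr{F}[C_p(X)]$ is $\pi$-UC. (6) $C_p(X)$ is SHD. (7) $C_p(X)$ is WSHD. (8) $C_p(X)$ is OHD. (9) $C_p(X)$ is UC. (10) $\chi(\overline{0},C_p(X))>\omega$. (11) $C_p(X)$ is $\pi$-UC. (12) $\pi\chi(\overline{0},C_p(X))>\omega$. (13) $X$ is uncountable.
   Context: $C_p(X)$ is the set of continuous functions $X\to\mathbb{R}$ with the topology of pointwise convergence. For a topological space $Y$, the Pixley-Roy hyperspace $\mathscr{F}[Y]$ is the set of all non-empty finite subsets of $Y$ with the topology having as a base all sets $[F,U]=\{G\in\mathscr{F}[Y] : F\subseteq G\subseteq U\}$, where $F\in\mathscr{F}[Y]$ and $U\subseteq Y$ is open. Let $Y$ be a topological space. - $Y$ is SHD if for every sequence $(U_n)_{n\in\omega}$ of non-empty open subsets of $Y$ one can pick $x_n\in U_n$ for each $n\in\omega$ so that $(x_n)$ has no convergent subsequence. - $Y$ is WSHD if for every sequence $(U_n)_{n\in\omega}$ of non-empty open subsets of $Y$ there are an infinite $A\subseteq\omega$ and points $x_n\in U_n$ for $n\in A$ such that $(x_n)_{n\in A}$ has no convergent subsequence. - A sequence $(U_n)_{n\in\omega}$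 of non-empty open sets converges to $y\in Y$ if for every open $U\ni y$ there is $m\in\omega$ with $U_n\subseteq U$ for all $n\geq m$. $Y$ is OHD if no sequence of non-empty open subsets of $Y$ converges to a point of $Y$. - A local $\pi$-basis for $y\in Y$ is a family $\mathscr{B}$ of non-empty open sets such that every open $U\ni y$ contains some $B\in\mathscr{B}$; it is a local base if moreover $y\in\bigcap\mathscr{B}$. $\chi(y,Y)$ (resp. $\pi\chi(y,Y)$) is the least cardinality of a local base (resp. local $\pi$-basis) for $y$ in $Y$. $Y$ is UC (resp. $\pi$-UC) if $\chi(y,Y)>\omega$ (resp. $\pi\chi(y,Y)>\omega$) for every $y\in Y$. *)

(* Defs.v *)
From HB Require Import structures.
From mathcomp Require Import all_boot all_order all_algebra finmap.
From mathcomp Require Import all_classical all_reals all_analysis.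

Set Implicit Arguments.
Unset Strict Implicit.
Unset Printing Implicit Defensive.

Import Order.TTheory GRing.Theory Num.Theory.
Import numFieldNormedType.Exports.

Local Open Scope classical_set_scope.
Local Open Scope ring_scope.
Local Open Scope card_scope.

Definition tychonoff_space (X : topologicalType) : Prop :=
  hausdorff_space X /\ completely_regular_space X.

(* The library's [completely_regular_space] is phrased with uniformities; this
   is the usual form of the axiom. *)
Lemma tychonoff_spaceP (R : realType) (X : topologicalType) :
  tychonoff_space X <->
  hausdorff_space X /\
  (forall (a : X) (B : set X), closed B -> ~ B a ->
     exists f : X -> R, [/\ continuous f, range f `<=` `[0, 1],
                            f a = 0 & forall b, B b -> f b = 1]).
Proof.
split=> -[hX sep]; split=> // a B cB nBa.
  have /(@uniform_separatorP _ R)[f [cf rf fa fB]] := sep a B cB nBa.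
  by exists f; split=> // [|b Bb]; [apply: fa; exists a | apply: fB; exists b].
have [f [cf rf fa fB]] := sep a B cB nBa.
apply/(@uniform_separatorP _ R); exists f; split=> //.
  by move=> _ [_ -> <-].
by move=> _ [b Bb <-]; exact: fB.
Qed.

Section Cp.
Variables (R : realType) (X : topologicalType).

(* The subspace topology inherited from the product topology on X -> R. *)
Definition Cp : Type :=
  initial_topology (fun f : continuousType X R => (f : {ptws X -> R})).

HB.instance Definition _ := Topological.on Cp.

Definition Cp0 : Cp := (cst 0 : X -> R) : continuousType X R.

End Cp.

Section PixleyRoy.
Variable Y : topologicalType.

Definition pixley_roy : Type := {F : {fset Y} | F != fset0}.

HB.instance Definition _ := Choice.on pixley_roy.

Definition pixley_roy_box (F : pixley_roy) (U : set Y) : set pixley_roy :=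
  [set G | [set` val F] `<=` [set` val G] /\ [set` val G] `<=` U].

Definition pixley_roy_base : set (set pixley_roy) :=
  [set B | exists F U, open U /\ B = pixley_roy_box F U].

Let pixley_roy_cover : \bigcup_(B in pixley_roy_base) id B = setT.
Proof.
apply/seteqP; split=> // F _; exists (pixley_roy_box F setT); last by split.
by exists F, setT; split=> //; exact: openT.
Qed.

Let pixley_roy_join (A B : set pixley_roy) (F : pixley_roy) :
  pixley_roy_base A -> pixley_roy_base B -> A F -> B F ->
  exists C, [/\ pixley_roy_base C, C F & C `<=` A `&` B].
Proof.
move=> [G [U [oU ->]]] [H [V [oV ->]]] [GF FU] [HF FV].
exists (pixley_roy_box F (U `&` V)); split.
- by exists F, (U `&` V); split=> //; exact: openI.
- by split=> // x Fx; split; [exact: FU | exact: FV].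
- move=> K [FK KUV]; split; split.
  + by apply: subset_trans FK.
  + by move=> x /KUV[].
  + by apply: subset_trans FK.
  + by move=> x /KUV[].
Qed.

HB.instance Definition _ :=
  isBaseTopological.Build pixley_roy pixley_roy_cover pixley_roy_join.

Lemma basis_pixley_roy : basis pixley_roy_base.
Proof.
split=> [B bB | F A /=].
  exists [set B]; last by rewrite bigcup_set1.
  by move=> C /= ->.
move=> [V [[D DB DV] VF VA]]; move: VF; rewrite -DV => -[B BD BF].
exists B; first by split=> //; exact: DB.
by move=> G BG; apply: VA; rewrite -DV; exists B.
Qed.

End PixleyRoy.

Section Notions.
Variable Y : topologicalType.

Definition has_cvg_subseq_in (A : set nat) (x : nat -> Y) : Prop :=
  exists (phi : nat -> nat) (y : Y),
    [/\ {homo phi : m n / (m < n)%N}, forall n, A (phi n) &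
        x \o phi @ \oo --> y].

Definition nonempty_open_seq (U : nat -> set Y) : Prop :=
  forall n, open (U n) /\ U n !=set0.

Definition SHD : Prop :=
  forall U : nat -> set Y, nonempty_open_seq U ->
  exists x : nat -> Y,
    (forall n, U n (x n)) /\ ~ has_cvg_subseq_in setT x.

(* The values of x outside A are irrelevant. *)
Definition WSHD : Prop :=
  forall U : nat -> set Y, nonempty_open_seq U ->
  exists (A : set nat) (x : nat -> Y),
    [/\ infinite_set A, forall n, A n -> U n (x n) &
        ~ has_cvg_subseq_in A x].

Definition set_seq_cvg (U : nat -> set Y) (y : Y) : Prop :=
  forall V : set Y, open V -> V y ->
  exists m : nat, forall n, (m <= n)%N -> U n `<=` V.

Definition OHD : Prop :=
  ~ exists (U : nat -> set Y) (y : Y), nonempty_open_seq U /\ set_seq_cvg U y.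

Definition local_pi_base (y : Y) : set (set (set Y)) :=
  [set B | (forall V, B V -> open V /\ V !=set0) /\
           (forall U, open U -> U y -> exists2 V, B V & V `<=` U)].

Definition local_base (y : Y) : set (set (set Y)) :=
  [set B | local_pi_base y B /\ (\bigcap_(V in B) V) y].

End Notions.

(* There is no type of cardinals: the least cardinality of a member of P is
   represented by a member of P that has it. *)
Definition least_card (T : Type) (P : set (set T)) : set T :=
  get [set K | P K /\ forall B, P B -> K #<= B].

Lemma least_cardP (T : pointedType) (P : set (set T)) : P !=set0 ->
  P (least_card P) /\ (forall B, P B -> least_card P #<= B).
Proof.
move=> [B0 PB0].
apply: (@getPex _ [set K | P K /\ forall B, P B -> K #<= B]).
pose good (F : set (set T -> T)) :=
  (forall f B, F f -> P B -> B (f B)) /\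
  (forall f g B, F f -> F g -> P B -> f B = g B -> f = g).
have [|F [[FB Finj] Fmax]] := @Zorn_bigcup _ good.
  move=> C Cgood Ctot; split=> [f B [F CF Ff]|f g B [F CF Ff] [G CG Gg]].
    exact: (Cgood _ CF).1.
  have [FG|GF] := Ctot _ _ CF CG.
    by apply: (Cgood _ CG).2 => //; exact: FG.
  by apply: (Cgood _ CF).2 => //; exact: GF.
have [K [PK KF]] : exists K, P K /\ K `<=` [set f K | f in F].
  apply: contrapT => noK.
  have ex B : exists x, P B -> B x /\ forall f, F f -> f B <> x.
    have [PB|nPB] := pselect (P B); last by exists point.
    have /existsNP[x /not_implyP[Bx nx]] : ~ B `<=` [set f B | f in F].
      by move=> BF; apply: noK; exists B.
    by exists x => _; split=> // f Ff fx; apply: nx; exists f.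
  have [g gP] := choice ex.
  apply: (Fmax (F `|` [set g])); first split.
  - by move=> f Ff; left.
  - move=> /(_ g (or_intror erefl)) Fg.
    by have [_ /(_ g Fg)] := gP B0 PB0.
  - split=> [f B [Ff|->] PB|f h B [Ff|->] [Fh|->] PB e //].
    + exact: (FB f B).
    + by have [] := gP B PB.
    + exact: (Finj _ _ B).
    + by have [_ /(_ f Ff)] := gP B PB; rewrite e.
    + by have [_ /(_ h Fh)] := gP B PB; rewrite e.
exists K; split=> // B PB.
have ex x : exists f, K x -> F f /\ f K = x.
  have [Kx|nKx] := pselect (K x); last by exists (fun=> point).
  by have [f Ff fx] := KF x Kx; exists f.
have [h hP] := choice ex.
have hB : set_fun K B (fun x => h x B).
  by move=> x Kx /=; exact: (FB _ B (hP x Kx).1 PB).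
have hI : set_inj K (fun x => h x B).
  move=> x y /set_mem Kx /set_mem Ky e.
  have [[Fx <-] [Fy <-]] := (hP x Kx, hP y Ky).
  by rewrite (Finj _ _ B Fx Fy PB e).
by apply/pcard_leP/injfunPex; exists (fun x => h x B).
Qed.

Section Characters.
Variable Y : topologicalType.

Definition character (y : Y) : set (set Y) := least_card (local_base y).

Definition pi_character (y : Y) : set (set Y) := least_card (local_pi_base y).

Definition UC : Prop := forall y : Y, ~ countable (character y).

Definition pi_UC : Prop := forall y : Y, ~ countable (pi_character y).

End Characters.

(* Main.v *)
(* If X is uncountable and U_n is a sequence of non-empty open subsets of C_p(X),
   each U_n restricts the values of functions on a finite set only, so some
   point a of X is restricted by no U_n. The sets {g | g a < m} then form an
   increasing open cover of C_p(X) none of whose members contains any U_n. The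
   existence of such covers passes from a space Y to its Pixley-Roy hyperspace
   (take the finite subsets of each member), and it implies SHD (choose x_n in
   U_n outside the n-th member) and pi-UC (let U_n enumerate a countable local
   pi-basis). Conversely, if X is countable then the constant function 0 has a
   countable local base in C_p(X), and so has {0} in the hyperspace. *)
From HB Require Import structures.
Require Import Defs.
From mathcomp Require Import all_boot all_order all_algebra finmap.
From mathcomp Require Import all_classical all_reals all_analysis.
Import Order.TTheory GRing.Theory Num.Theory.
Import numFieldNormedType.Exports.

Local Open Scope classical_set_scope.

(** * Characters and countable local bases *)

Section Characters.
Context {Y : topologicalType}.
Implicit Types (y : Y) (B : set (set Y)).

(** Provides the member that [least_cardP] needs before either character can be used. *)
Lemma local_base_open_nbhs y : local_base y (open_nbhs y).
Proof.
split; last by move=> U [].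
split=> [V [oV Vy]|U oU Uy]; first by split=> //; exists y.
by exists U.
Qed.

Lemma countable_least_card (T : pointedType) (P : set (set T)) : P !=set0 ->
  countable (least_card P) <-> exists2 B, P B & countable B.
Proof.
move=> /least_cardP[PL leL]; split=> [cL|[B PB]]; first by exists (least_card P).
exact/sub_countable/leL.
Qed.

Lemma countable_characterP y :
  countable (character y) <-> exists2 B, local_base y B & countable B.
Proof.
apply: countable_least_card; eexists; exact: local_base_open_nbhs.
Qed.

Lemma countable_pi_characterP y :
  countable (pi_character y) <-> exists2 B, local_pi_base y B & countable B.
Proof.
apply: countable_least_card; eexists; exact: (local_base_open_nbhs y).1.
Qed.

Lemma local_pi_base_enum y B : local_pi_base y B -> countable B ->
  exists V : nat -> set Y, range V = B.
Proof.
move=> [_ /(_ setT openT I)[V0 BV0 _]] /pcard_surjP[g gB].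
(* [g] may leave [B]; such indices get [V0], which exists because the whole space contains a member
   of [B]. *)
exists (fun n => if g n \in B then g n else V0).
apply/seteqP; split=> [_ [n _ <-]|V BV].
  by case: ifPn => // /set_mem.
by have [n _ gn] := gB V BV; exists n => //; rewrite gn mem_set.
Qed.

Lemma countable_pi_character_le y :
  countable (character y) -> countable (pi_character y).
Proof.
move=> /countable_characterP[B [piB _] cB].
by apply/countable_pi_characterP; exists B.
Qed.

Lemma set_seq_cvg_character y : countable (character y) ->
  exists2 U, nonempty_open_seq U & set_seq_cvg U y.
Proof.
move=> /countable_characterP[B [piB By] cB].
have [V VB] := local_pi_base_enum _ _ piB cB.
have BV n : B (V n) by rewrite -VB; exists n.
(* These intersections are non-empty because they contain [y]; from index [m] on they lie inside
   [V m]. *)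
exists (fun n => \bigcap_(i < n.+1) V i) => [n|W oW Wy].
  split; last by exists y => i _; exact: By.
  rewrite bigcap_mkord; apply: big_ind => [|A C|i _]; first exact: openT.
    exact: openI.
  exact: (piB.1 _ (BV i)).1.
have [_ /(_ W oW Wy)] := piB; rewrite -VB => -[_ [m _ <-] VW].
by exists m => n mn z /(_ m) Vz; apply/VW/Vz; rewrite /= ltnS.
Qed.

End Characters.

(** * Implications valid in every space *)

Section Implications.
Context {Y : topologicalType}.

Lemma SHD_WSHD : SHD Y -> WSHD Y.
Proof.
move=> shd U /shd[x [Ux ncvg]]; exists setT, x; split=> //.
exact: infinite_nat.
Qed.

(** Points chosen from sets that converge to [y] converge to [y] along any increasing sequence of
    indices, and an infinite [A] contains one. *)
Lemma WSHD_OHD : WSHD Y -> OHD Y.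
Proof.
move=> wshd [U [y [oU Uy]]]; have [A [x [infA Ux []]]] := wshd U oU.
have next n : exists m, A m /\ (n < m)%N.
  apply: contrapT => noA; apply: infA.
  apply: (@sub_finite_set _ _ `I_n.+1); last exact: finite_II.
  move=> m Am /=; rewrite ltnNge; apply/negP => nm.
  by apply: noA; exists m.
have [s sP] := choice next.
(* The iteration starts at 0, which need not lie in [A]; hence [n.+1]. *)
exists (fun n => iter n.+1 s 0%N), y; split=> [|n|].
- apply: homo_ltn; first exact: ltn_trans.
  by move=> n; rewrite [ltnRHS]iterS; case: (sP (iter n.+1 s 0%N)).
- by rewrite iterS; case: (sP (iter n s 0%N)).
move=> W; rewrite /= nbhsE => -[V [oV Vy] VW].
have [m Um] := Uy V oV Vy; exists m => // n /= mn; apply: VW.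
have iter_ge k : (k <= iter k s 0)%N.
  elim: k => // k IHk; rewrite iterS (leq_ltn_trans IHk)//.
  by case: (sP (iter k s 0%N)).
apply: (Um (iter n.+1 s 0%N)).
  exact: leq_trans mn (ltnW (iter_ge n.+1)).
by apply: Ux; rewrite iterS; case: (sP (iter n s 0%N)).
Qed.

Lemma OHD_UC : OHD Y -> UC Y.
Proof.
move=> ohd y /set_seq_cvg_character[U oU Uy].
by apply: ohd; exists U, y.
Qed.

Lemma pi_UC_UC : pi_UC Y -> UC Y.
Proof. by move=> puc y /countable_pi_character_le; exact: puc. Qed.

End Implications.

(** * Escaping increasing open covers *)

Section Escapable.
Context {Y : topologicalType}.

(** Isolates, in purely topological terms, the unboundedness of evaluation at an unrestricted point,
    so that it can be transferred to the hyperspace. *)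
Definition escapable : Prop :=
  forall U : nat -> set Y, nonempty_open_seq U ->
  exists C : nat -> set Y,
    [/\ forall m, open (C m),
        {homo C : m n / (m <= n)%N >-> m `<=` n},
        \bigcup_m C m = setT &
        forall n m, ~ U n `<=` C m].

(** For [x n] outside [C n], a subsequential limit would lie in some [C m], which then contains a
    term [x k] with [k >= m], although [C m] lies in [C k]. *)
Lemma escapable_SHD : escapable -> SHD Y.
Proof.
move=> escY U oU; have [C [oC leC covC UC]] := escY U oU.
have /choice[x xP] : forall n, exists x, U n x /\ ~ C n x.
  by move=> n; have /existsNP[x /not_implyP] := UC n n; exists x.
exists x; split=> [n|[phi [y [phi_incr _ cvg_x]]]]; first by have [] := xP n.
have [m _ Cmy] : (\bigcup_m C m) y by rewrite covC.
have phi_ge n : (n <= phi n)%N.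
  by elim: n => // n IHn; rewrite (leq_ltn_trans IHn)// phi_incr.
have [N _ xC] := cvg_x (C m) (open_nbhs_nbhs (conj (oC m) Cmy)).
have k_ge : (m <= phi (maxn m N))%N by rewrite (leq_trans (leq_maxl m N)).
apply: (xP (phi (maxn m N))).2; apply: leC k_ge _ _.
by apply: xC => /=; rewrite leq_maxr.
Qed.

Lemma escapable_pi_UC : escapable -> pi_UC Y.
Proof.
move=> escY y /countable_pi_characterP[B piB cB].
have [V VB] := local_pi_base_enum _ _ piB cB.
have [|C [oC _ covC VC]] := escY V.
  by move=> n; apply: piB.1; rewrite -VB; exists n.
have [m _ Cmy] : (\bigcup_m C m) y by rewrite covC.
have [_ /(_ _ (oC m) Cmy)] := piB; rewrite -VB => -[_ [n _ <-]].
exact: VC.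
Qed.

End Escapable.
Arguments escapable : clear implicits.

(** * Pixley-Roy hyperspaces *)

Section PixleyRoyTheory.
Context {Y : topologicalType}.
Implicit Types (F : pixley_roy Y) (U : set Y).

Lemma pixley_roy_point F : exists y, y \in val F.
Proof. by case: F => F /= /fset0Pn. Qed.

Lemma open_pixley_roy_box F U : open U -> open (pixley_roy_box F U).
Proof.
move=> oU; apply: (basis_pixley_roy Y).1; by exists F, U.
Qed.

Lemma open_pixley_roy_sub U : open U ->
  open [set F : pixley_roy Y | [set` val F] `<=` U].
Proof.
move=> oU; rewrite openE => F FU; rewrite /interior nbhsE.
exists (pixley_roy_box F U); last by move=> G [].
by split; [exact: open_pixley_roy_box | split].
Qed.

(** A basic box [G, U] around [F] contains [F, U], so the lower bound can be [F] itself. *)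
Lemma pixley_roy_box_nbhs F (W : set (pixley_roy Y)) : open W -> W F ->
  exists U, [/\ open U, [set` val F] `<=` U & pixley_roy_box F U `<=` W].
Proof.
move=> oW WF; have [_ /(_ F _ (open_nbhs_nbhs (conj oW WF)))] := basis_pixley_roy Y.
move=> [_ [[G [U [oU ->]]] [GF FU]] GUW]; exists U; split=> // H [FH HU].
by apply: GUW; split=> //; exact: subset_trans FH.
Qed.

Lemma escapable_pixley_roy : escapable Y -> escapable (pixley_roy Y).
Proof.
move=> escY U oU.
have /choice[W WP] : forall n, exists W, [/\ open W, W !=set0 &
    exists2 F : pixley_roy Y, [set` val F] `<=` W & pixley_roy_box F W `<=` U n].
  move=> n; have [oUn [F UF]] := oU n.
  have [W [oW FW WU]] := pixley_roy_box_nbhs _ _ oUn UF.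
  have [y Fy] := pixley_roy_point F.
  by exists W; split=> //; [exists y; exact: FW|exists F].
have [n|C [oC leC covC WC]] := escY W; first by have [] := WP n.
exists (fun m => [set F : pixley_roy Y | [set` val F] `<=` C m]); split.
- by move=> m; exact: open_pixley_roy_sub.
- by move=> m n mn F FC; apply: subset_trans FC _; exact: leC.
- apply/seteqP; split=> // F _.
  have /choice[k kP] : forall y, exists m, C m y.
    move=> y; have [m _ Cmy] : (\bigcup_m C m) y by rewrite covC.
    by exists m.
  (* The cover increases, so a finite set lies in the member with the largest index needed by its
     points. *)
  exists (\max_(y <- val F) k y)%N => // y /= Fy.
  by apply: leC (kP y); exact: leq_bigmax_seq.
(* Adding any point [y] of [W n] to [F] stays in the box inside [U n], which forces [y] into
   [C m]. *)
move=> n m UC; apply: (WC n m) => y Wy.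
have [_ _ [F FW FWU]] := WP n.
have Fy0 : (y |` val F)%fset != fset0.
  by apply/fset0Pn; exists y; rewrite fset1U1.
apply: (UC (exist _ (y |` val F)%fset Fy0)); last by rewrite /= fset1U1.
apply: FWU; split=> z /=; first by move=> Fz; rewrite in_fsetU Fz orbT.
by rewrite in_fset1U => /orP[/eqP->//|]; exact: FW.
Qed.

Lemma countable_character_pixley_roy1 (y : Y) : countable (character y) ->
  exists F : pixley_roy Y, countable (character F).
Proof.
move=> /countable_characterP[B [[Bo Bsub] By] cB].
have y0 : [fset y]%fset != fset0 by apply/fset0Pn; exists y; rewrite inE.
pose F : pixley_roy Y := exist _ [fset y]%fset y0.
exists F; apply/countable_characterP.
have FV V : B V -> [set` val F] `<=` V.
  by move=> BV z /=; rewrite inE => /eqP->; exact: By.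
exists (pixley_roy_box F @` B); last exact: sub_countable (card_image_le _ _) cB.
split; last by move=> _ [V BV <-]; split=> //; exact: FV.
split=> [_ [V BV <-]|W oW WF].
  split; first by apply: open_pixley_roy_box; exact: (Bo V BV).1.
  by exists F; split=> //; exact: FV.
have [U [oU FU UW]] := pixley_roy_box_nbhs _ _ oW WF.
have [|V BV VU] := Bsub U oU; first by apply: FU; rewrite /= inE.
exists (pixley_roy_box F V); first by exists V.
apply: subset_trans UW => G [FG GV]; split=> //.
exact: subset_trans VU.
Qed.

End PixleyRoyTheory.

(** * Function spaces with the pointwise topology *)

Section CpTheory.
Context {R : realType} {X : topologicalType}.
Local Open Scope ring_scope.
Implicit Types (f g : Cp R X) (s : seq X).

(** Basic neighbourhoods of the pointwise topology; the finite set is a list, which allows induction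
    on it. *)
Definition Cp_ball f s (e : R) : set (Cp R X) :=
  [set g | forall x, x \in s -> `|f x - g x| < e].

Lemma Cp_eval_continuous x : continuous (fun f : Cp R X => f x).
Proof.
move=> f.
apply: (@continuous_comp (Cp R X) {ptws X -> R} R
  (fun g => (g : continuousType X R) : {ptws X -> R}) (fun h => h x)).
  exact: initial_continuous.
exact: proj_continuous.
Qed.

Lemma open_Cp_ball f s e : open (Cp_ball f s e).
Proof.
elim: s => [|x s IHs].
  by rewrite (_ : Cp_ball f [::] e = setT); [exact: openT|apply/seteqP].
rewrite (_ : Cp_ball f (x :: s) e =
    (fun g : Cp R X => g x) @^-1` ball (f x) e `&` Cp_ball f s e).
  apply: openI => //; apply: open_comp; last exact: ball_open.
  by move=> g _; exact: Cp_eval_continuous.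
apply/seteqP; split=> [g gP|g [gx gs] z].
  split; first by apply: gP; rewrite mem_head.
  by move=> z zs; apply: gP; rewrite in_cons zs orbT.
by rewrite in_cons => /orP[/eqP->//|]; exact: gs.
Qed.

Lemma Cp_ball_center f s e : 0 < e -> Cp_ball f s e f.
Proof. by move=> e0 x _; rewrite subrr normr0. Qed.

Lemma Cp_ball_nbhs f (U : set (Cp R X)) : open U -> U f ->
  exists s e, 0 < e /\ Cp_ball f s e `<=` U.
Proof.
move=> oU Uf.
pose D := [set se : seq X * R | 0 < se.2].
(* It suffices that the filter [G] generated by the balls converges to [f]; for an initial topology
   and then a product this is checked one coordinate at a time. *)
pose G := filter_from D (fun se => Cp_ball f se.1 se.2).
have GF : Filter G.
  apply: filter_from_filter; first by exists ([::], 1); rewrite /D /=.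
  move=> [s e] [t d] /= e0 d0; exists (s ++ t, Num.min e d).
    by rewrite /D /= lt_min e0.
  move=> g gP; split=> x xs; have := gP x; rewrite /= mem_cat xs ?orbT.
    by move=> /(_ isT); rewrite lt_min => /andP[].
  by move=> /(_ isT); rewrite lt_min => /andP[].
suff /(_ U (open_nbhs_nbhs (conj oU Uf)))[[s e] /= e0 sub] : G --> f.
  by exists s, e.
pose emb (g : Cp R X) : {ptws X -> R} := (g : continuousType X R).
suff Gf : emb @ G --> emb f.
  move=> A [_ [[B oB <-] Bf BA]].
  apply: filterS BA _; exact: Gf (open_nbhs_nbhs (conj oB Bf)).
apply/cvg_sup => x A [_ [[B oB <-] Bf BA]].
apply: filterS BA _.
have /nbhs_ballP[e e0 eB] : nbhs (f x) B by exact: open_nbhs_nbhs.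
exists ([:: x], e) => // g /= gP; apply: eB.
by apply: gP; rewrite mem_head.
Qed.

Lemma Cp_modify (XT : tychonoff_space X) f s (a : X) (c : R) : a \notin s ->
  exists g : Cp R X, {in s, g =1 f} /\ g a = c.
Proof.
move=> nsa; have [hX sep] := (tychonoff_spaceP R X).1 XT.
have cs : closed [set` s].
  move/hausdorff_accessible/accessible_finite_set_closed: hX; apply.
  exact: finite_seq.
have [|h [ch _ ha hs]] := sep a _ cs; first exact/negP.
(* As [h] is 0 at [a] and 1 on [s], this function is [c] at [a] and agrees with [f] on [s]. *)
have cont : continuous (fun x => c + h x * (f x - c)).
  move=> x; apply: cvgD; first exact: cvg_cst.
  apply: cvgM; first exact: ch.
  apply: cvgB; [exact: cts_fun|exact: cvg_cst].
pose mg := @isContinuous.Build X R _ cont.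
pose g : continuousType X R := HB.pack (fun x => c + h x * (f x - c)) mg.
exists (g : Cp R X); split=> [x xs|] /=; last by rewrite ha mul0r addr0.
by rewrite hs// mul1r addrC subrK.
Qed.

Lemma escapable_Cp : tychonoff_space X -> ~ countable [set: X] ->
  escapable (Cp R X).
Proof.
move=> XT ncX U oU.
(* The radius is dropped: agreement with the centre on the finite set already gives membership. *)
have /choice[p pP] : forall n, exists p : Cp R X * seq X,
    forall g, {in p.2, g =1 p.1} -> U n g.
  move=> n; have [oUn [f Uf]] := oU n.
  have [s [e [e0 sU]]] := Cp_ball_nbhs _ _ oUn Uf.
  by exists (f, s) => g gf; apply: sU => x xs; rewrite gf// subrr normr0.
(* Countably many finite sets cannot cover an uncountable [X]. *)
have [a na] : exists a, forall n, a \notin (p n).2.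
  apply: contrapT => noa; apply: ncX.
  apply: (@sub_countable _ _ _ (\bigcup_n [set` (p n).2])); last first.
    by apply: bigcup_countable => // n _; exact/finite_set_countable/finite_seq.
  apply: subset_card_le => a _; apply: contrapT => nUa.
  by apply: noa; exists a => n; apply/negP => an; apply: nUa; exists n.
exists (fun m => (fun g : Cp R X => g a) @^-1` [set t | t < m%:R]); split.
- move=> m; apply: open_comp; last exact: open_lt.
  by move=> g _; exact: Cp_eval_continuous.
- by move=> m n mn g /= /lt_le_trans; apply; rewrite ler_nat.
- apply/seteqP; split=> // g _; exists (Num.truncn (g a)).+1 => //=.
  exact: truncnS_gt.
(* A function in [U n] with value exactly [m] at [a] escapes the member of index [m]. *)
- move=> n m UC; have [g [gs ga]] := Cp_modify XT (p n).1 _ _ m%:R (na n).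
  by have /= := UC g (pP n g gs); rewrite ga ltxx.
Qed.

Lemma countable_character_Cp0 : countable [set: X] ->
  countable (character (Cp0 R X)).
Proof.
move=> /countable_injP[i iI]; apply/countable_characterP.
pose b (p : seq X * nat) := Cp_ball (Cp0 R X) p.1 p.2.+1%:R^-1.
exists (range b); last first.
  apply: sub_countable (card_image_le _ _) _; apply/countable_injP.
  (* Lists over [X] become lists of naturals through the injection [i], which makes the pairs
     encodable. *)
  exists (fun p => choice.pickle (map i p.1, p.2)) => -[s m] [t n] _ _ /=.
  move=> /(pcan_inj choice.pickleK)[+ ->] => /inj_map-> // x y.
  by apply: iI; rewrite in_setT.
have b0 p : b p (Cp0 R X) by apply: Cp_ball_center; rewrite invr_gt0.
split; last by move=> _ [p _ <-].
split=> [_ [p _ <-]|U oU U0].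
  by split; [exact: open_Cp_ball|exists (Cp0 R X)].
have [s [e [e0 sU]]] := Cp_ball_nbhs _ _ oU U0.
(* The radius [1 / (truncn (1 / e) + 1)] is below [e]. *)
exists (b (s, Num.truncn e^-1)); first by exists (s, Num.truncn e^-1).
apply: subset_trans sU => g gP x xs; apply: lt_trans (gP x xs) _.
by rewrite invf_plt ?posrE// truncnS_gt.
Qed.

End CpTheory.

Theorem theorem13 (R : realType) (X : topologicalType)
    (X_tychonoff : tychonoff_space X) (X_two_points : exists x y : X, x <> y) :
  [<-> SHD (pixley_roy (Cp R X));
       WSHD (pixley_roy (Cp R X));
       OHD (pixley_roy (Cp R X));
       UC (pixley_roy (Cp R X));
       pi_UC (pixley_roy (Cp R X));
       SHD (Cp R X);
       WSHD (Cp R X);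
       OHD (Cp R X);
       UC (Cp R X);
       ~ countable (character (Cp0 R X));
       pi_UC (Cp R X);
       ~ countable (pi_character (Cp0 R X));
       ~ countable [set: X]].
Proof.
have esc : ~ countable [set: X] -> escapable (Cp R X) by exact: escapable_Cp.
have UC_uncountable : UC (pixley_roy (Cp R X)) -> ~ countable [set: X].
  move=> uc /(@countable_character_Cp0 R)/countable_character_pixley_roy1[F].
  exact: uc.
(* The implications between distinct spaces, and those from a character back to a stronger property,
   pass through the uncountability of [X]. *)
tfae.
- exact: SHD_WSHD.
- exact: WSHD_OHD.
- exact: OHD_UC.
- by move=> /UC_uncountable/esc/escapable_pixley_roy/escapable_pi_UC.
- by move=> /pi_UC_UC/UC_uncountable/esc/escapable_SHD.
- exact: SHD_WSHD.
- exact: WSHD_OHD.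
- exact: OHD_UC.
- exact.
- move=> nc; apply: escapable_pi_UC; apply: esc.
  by move=> /(@countable_character_Cp0 R).
- exact.
- by move=> nc /(@countable_character_Cp0 R)/countable_pi_character_le.
- by move=> /esc/escapable_pixley_roy/escapable_SHD.
Qed.
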